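(* There is no positive bilinear multiplication $\star: H\times H\to H$ such that $$(f\otimes g)\star(h\otimes k)=(f\cdot_A h)\otimes(g\cdot_B k)$$ for all $f,h\in A$ and all $g,k\in B$. Here $H=X\mathbin{\bar\otimes}X$ with $X=C([0,1])$ is the Fremlin tensor product of the underlying vector lattices of the almost $f$-algebras $A=(X,\cdot_A)$ and $B=(X,\cdot_B)$ defined in the context.
   Context: Let $I=[0,1]$ and let $X=C(I)$ be the vector lattice of continuous real-valued functions on $I$ with pointwise order. The Fremlin (Riesz) tensor product $H=X\mathbin{\bar\otimes}X$ is identified with the Riesz subspace (vector sublattice) of $C(I^2)$ generated by the algebraic tensor product $X\otimes X$, where $(f\otimes g)(s,t)=f(s)g(t)$; its order is the pointwise order of $C(I^2)$. A bilinear multiplication $\star$ on $H$ is positive if $z\star w\ge 0$ whenever $z,w\in H$ satisfy $z\ge0$, $w\ge 0$. No associativity or commutativity of $\star$ is assumed. For $s\in I$ put $$a(s)=\frac{e^s+1+s}{2},\qquad b(s)=\frac{1+(1-s)e^s}{2},$$ and define $S_0:X\to X$ by $$(S_0f)(s)=a(s)f(0)+b(s)f(1)+\frac{s^2}{2}\int_0^1 e^{sx}f(x)\,dx .$$ Define $P:X\to X$ by $(Pf)(u)=f(u/3)$ for $u\in I$. Let $\sigma(r)=\max\{3r-2,0\}$ for $r\in I$, and let $\eta:I\to\mathbb{R}$ be given by $\eta(r)=0$ for $0\le r\le\frac12$, $\eta(r)=6r-3$ for $\frac12\le r\le\frac23$, and $\eta(r)=1$ for $\frac23\le r\le 1$.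 Define $E:X\to X$ by $(Eg)(r)=\eta(r)\,g(\sigma(r))$. The two products on $X$ are $$f\cdot_A g=E\bigl(S_0((Pf)(Pg))\bigr),\qquad f\cdot_B g=E\bigl((Pf)(Pg)\bigr),$$ where $(Pf)(Pg)$ is the pointwise product. Write $A=(X,\cdot_A)$ and $B=(X,\cdot_B)$. *)

(* Defs.v *)
From mathcomp Require Import all_boot all_order all_algebra.
From mathcomp Require Import all_classical all_reals all_analysis.
From mathcomp Require Import lra.

Set Implicit Arguments.
Unset Strict Implicit.
Unset Printing Implicit Defensive.
Import Order.TTheory GRing.Theory Num.Theory.
Import numFieldNormedType.Exports.
Local Open Scope classical_set_scope.
Local Open Scope ring_scope.

Definition Cspace (R : realType) (T : topologicalType) : set (T -> R) :=
  [set f | continuous f].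

Definition riesz_subspace (R : realType) (T : Type) (V : set (T -> R)) : Prop :=
  [/\ V (cst 0),
      forall z w, V z -> V w -> V (z \+ w),
      forall (c : R) z, V z -> V (c \*o z) &
      forall z w, V z -> V w -> V (z \max w)].

Section UnitInterval.
Variable R : realType.

(* The topology is the one induced by the inclusion into [R]. *)
Definition unit_itv : topologicalType := set_type (`[0, 1]%classic : set R).

Definition ival (s : unit_itv) : R := set_val s.

Lemma ivalP (s : unit_itv) : 0 <= ival s <= 1.
Proof. by have := set_mem (svalP s); rewrite /= in_itv. Qed.

Definition mk_itv (x : R) (x01 : 0 <= x <= 1) : unit_itv :=
  SigSub (mem_set (x01 : `[0, 1]%classic x)).

Lemma continuous_ival : continuous ival.
Proof. exact: (@initial_continuous _ _ set_val). Qed.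

Lemma continuous_mk_itv (f : unit_itv -> R) (f01 : forall s, 0 <= f s <= 1) :
  continuous f -> continuous (fun s => mk_itv (f01 s)).
Proof. by move=> cf; apply: continuous_comp_initial. Qed.

Fact itv0_subproof : 0 <= (0 : R) <= 1.
Proof. by rewrite lexx ler01. Qed.

Fact itv1_subproof : 0 <= (1 : R) <= 1.
Proof. by rewrite lexx ler01. Qed.

Definition itv0 : unit_itv := mk_itv itv0_subproof.
Definition itv1 : unit_itv := mk_itv itv1_subproof.

Definition CI : set (unit_itv -> R) := @Cspace R unit_itv.

Definition elem_tensor (f g : unit_itv -> R) : unit_itv * unit_itv -> R :=
  fun p => f p.1 * g p.2.

Definition alg_tensor : set (unit_itv * unit_itv -> R) :=
  [set z | exists (n : nat) (f g : 'I_n -> unit_itv -> R),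
    [/\ forall i, CI (f i), forall i, CI (g i) &
        z = fun p => \sum_(i < n) elem_tensor (f i) (g i) p]].

(* The intersection is taken over the Riesz subspaces of all functions on the
   square; it lies in C(I^2) by [fremlin_tensor_continuous] below, so this is
   also the Riesz subspace of C(I^2) generated by [alg_tensor]. *)
Definition fremlin_tensor : set (unit_itv * unit_itv -> R) :=
  smallest (@riesz_subspace R (unit_itv * unit_itv)%type) alg_tensor.

Lemma riesz_Cspace (T : topologicalType) : riesz_subspace (@Cspace R T).
Proof.
split=> [|z w cz cw p|c z cz p|z w cz cw p].
- exact: cst_continuous.
- exact: (@continuousD _ R^o _ _ _ _ (cz p) (cw p)).
- exact: (@continuousM _ _ (cst c) z p (@cst_continuous _ _ c p) (cz p)).
- exact: (@continuous_max R T z w p (cz p) (cw p)).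
Qed.

Lemma continuous_elem_tensor f g : CI f -> CI g -> continuous (elem_tensor f g).
Proof.
move=> cf cg p; apply: (@continuousM _ _ (f \o fst) (g \o snd) p).
  by apply: continuous_comp; [exact: cvg_fst | exact: cf].
by apply: continuous_comp; [exact: cvg_snd | exact: cg].
Qed.

Lemma fremlin_tensor_continuous :
  fremlin_tensor `<=` @Cspace R (unit_itv * unit_itv)%type.
Proof.
apply: smallest_sub; first exact: riesz_Cspace.
move=> _ [n [f [g [cf cg ->]]]].
apply: (@continuous_big R _ +%R 0 xpredT) => [|i _].
  move=> q; exact: (@continuousD _ R^o _ fst snd q cvg_fst cvg_snd).
exact: (continuous_elem_tensor (cf i) (cg i)).
Qed.

Lemma fremlin_tensor_elem f g :
  CI f -> CI g -> fremlin_tensor (elem_tensor f g).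
Proof.
move=> cf cg; apply: sub_gen_smallest.
exists 1, (fun=> f), (fun=> g); split=> //.
by apply/funext => p; rewrite big_ord1.
Qed.

Definition coef_a (s : R) : R := (expR s + 1 + s) / 2.
Definition coef_b (s : R) : R := (1 + (1 - s) * expR s) / 2.

(* ['valL_0 f] extends [f : unit_itv -> R] to the real line by 0. *)
Definition S0 (f : unit_itv -> R) : unit_itv -> R := fun s =>
  coef_a (ival s) * f itv0 + coef_b (ival s) * f itv1 +
  ival s ^+ 2 / 2 *
    \int[lebesgue_measure]_(x in `[0, 1]) (expR (ival s * x) * 'valL_0 f x).

Lemma ext_ival (f : unit_itv -> R) (s : unit_itv) : 'valL_0 f (ival s) = f s.
Proof. by have := congr1 (fun h => h s) (@valLK _ _ (0 : R) _ f). Qed.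

Lemma ext_itv_continuous (f : unit_itv -> R) :
  CI f -> {within `[0, 1], continuous ('valL_0 f)}.
Proof. by move=> cf; apply/subspace_sigL_continuousP; rewrite valLK. Qed.

Fact third_subproof (u : unit_itv) : 0 <= ival u / 3 <= 1.
Proof.
have /andP[u0 u1] := ivalP u.
by rewrite divr_ge0//= ler_pdivrMr// mul1r (le_trans u1)// ler1n.
Qed.

Definition opP (f : unit_itv -> R) : unit_itv -> R :=
  fun u => f (mk_itv (third_subproof u)).

Fact sigma_subproof (r : unit_itv) : 0 <= Num.max (3 * ival r - 2) 0 <= 1.
Proof.
have /andP[r0 r1] := ivalP r.
rewrite le_max lexx orbT/= ge_max ler01 andbT lerBlDr -[1 + 2]/(3 : R).
by rewrite ger_pMr.
Qed.

Definition sigma (r : unit_itv) : unit_itv := mk_itv (sigma_subproof r).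

Definition eta (r : unit_itv) : R :=
  if ival r <= 1 / 2 then 0
  else if ival r <= 2 / 3 then 6 * ival r - 3
  else 1.

Definition opE (g : unit_itv -> R) : unit_itv -> R :=
  fun r => eta r * g (sigma r).

Lemma CI_opP f : CI f -> CI (opP f).
Proof.
move=> cf u; apply: continuous_comp; last exact: cf.
apply: continuous_mk_itv => {}u.
by apply: (@continuousM _ _ ival (cst _) u);
  [exact: continuous_ival | exact: cst_continuous].
Qed.

Lemma CI_M f g : CI f -> CI g -> CI (f \* g).
Proof. by move=> cf cg u; exact: (@continuousM _ _ f g u (cf u) (cg u)). Qed.

Lemma etaE (r : unit_itv) : eta r = Num.min 1 (Num.max 0 (6 * ival r - 3)).
Proof.
rewrite /eta; case: (leP (ival r) (1 / 2)) => h1;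
  case: (leP (ival r) (2 / 3)) => h2;
  case: (leP 0 (6 * ival r - 3)) => h3;
  case: leP => h4; lra.
Qed.

Lemma continuous_affine (c d : R) : continuous (fun r => c * ival r - d).
Proof.
move=> r; apply: (@continuousB _ R^o _ (fun r => c * ival r) (cst d));
  last exact: cst_continuous.
apply: (@continuousM _ _ (cst c) ival r); first exact: cst_continuous.
exact: continuous_ival.
Qed.

Lemma CI_eta : CI eta.
Proof.
have -> : eta = cst 1 \min (cst 0 \max (fun r => 6 * ival r - 3)).
  by apply/funext => r; exact: etaE.
move=> r; apply: (@continuous_min R _ (cst 1)); first exact: cst_continuous.
apply: (@continuous_max R _ (cst 0)); first exact: cst_continuous.
exact: continuous_affine.
Qed.

Lemma CI_opE g : CI g -> CI (opE g).
Proof.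
move=> cg; apply: CI_M; first exact: CI_eta.
move=> r; apply: continuous_comp; last exact: cg.
apply: continuous_mk_itv => {}r.
apply: (@continuous_max R _ (fun r => 3 * ival r - 2) (cst 0)).
  exact: continuous_affine.
exact: cst_continuous.
Qed.

Lemma continuous_integral_exp (h : R -> R) (s : R) : -1 < s < 2 ->
  {within `[0, 1], continuous h} ->
  {for s, continuous (fun s : R =>
     \int[lebesgue_measure]_(x in `[0, 1]) (expR (s * x) * h x))}.
Proof.
move=> s12 ch.
have ih (f : R -> R) : {within `[0, 1], continuous f} ->
    lebesgue_measure.-integrable `[0, 1] (EFin \o f).
  by apply: continuous_compact_integrable; exact: segment_compact.
have chM (f : R -> R) : continuous f -> {within `[0, 1], continuous (f \* h)}.
  move=> cf x.
  apply: (@continuousM R (subspace (`[0, 1]%classic : set R)) f h x);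
    last exact: ch.
  exact: (continuous_subspaceT cf).
have cE t : continuous (fun x : R => expR (t * x)).
  move=> x; apply: continuous_comp; last exact: continuous_expR.
  exact: mulrl_continuous.
apply: (@continuity_under_integral R _ (measurableTypeR R) lebesgue_measure
  (fun s x => expR (s * x) * h x) `[0, 1]%classic _ (-1) 2 _ _
  (fun x => expR 2 * `|h x|)) => //; last by rewrite inE/= in_itv.
- by move=> t _; apply: ih; apply: chM.
- apply: aeW => y _ t _.
  apply: (@continuousM R R (fun t => expR (t * y)) (cst (h y))).
    apply: continuous_comp; last exact: continuous_expR.
    exact: mulrr_continuous.
  exact: cst_continuous.
- apply: ih => x.
  apply: (@continuousM R (subspace (`[0, 1]%classic : set R))
    (cst (expR 2)) (fun x => `|h x|)).
    exact: cst_continuous.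
  apply: continuous_comp; [exact: ch | exact: norm_continuous].
- move=> t /=; rewrite in_itv/= => /andP[t1 t2]; apply: aeW => y /=.
  rewrite in_itv/= => /andP[y0 y1].
  rewrite normrM ger0_norm ?expR_ge0// ler_wpM2r// ler_expR; nra.
Qed.

Lemma CI_S0 f : CI f -> CI (S0 f).
Proof.
move=> cf; pose F (s : R) := coef_a s * f itv0 + coef_b s * f itv1 +
  s ^+ 2 / 2 *
    \int[lebesgue_measure]_(x in `[0, 1]) (expR (s * x) * 'valL_0 f x).
have cid (s : R) : {for s, continuous (fun x : R => x)} by move=> ?.
have cc (c s : R) : {for s, continuous (fun _ : R => c)}
  by exact: cst_continuous.
have cexp (s : R) : {for s, continuous (@expR R)} by exact: continuous_expR.
have cD (u v : R -> R) s : {for s, continuous u} -> {for s, continuous v} ->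
  {for s, continuous (fun x => u x + v x)} by exact: (@continuousD _ R^o).
have cB (u v : R -> R) s : {for s, continuous u} -> {for s, continuous v} ->
  {for s, continuous (fun x => u x - v x)} by exact: (@continuousB _ R^o).
have cM (u v : R -> R) s : {for s, continuous u} -> {for s, continuous v} ->
  {for s, continuous (fun x => u x * v x)} by exact: continuousM.
move=> u; apply: (@continuous_comp _ _ _ ival F); first exact: continuous_ival.
have /andP[u0 u1] := ivalP u.
rewrite /F /coef_a /coef_b; apply: (cD).
  by do ![exact: cid|exact: cc|exact: cexp|apply: (cB)|apply: (cD)|apply: (cM)].
apply: (cM); first by do ![exact: cid|exact: cc|apply: (cM)].
apply: continuous_integral_exp; last exact: ext_itv_continuous.
by apply/andP; split; lra.
Qed.

Definition prodA (f g : unit_itv -> R) : unit_itv -> R :=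
  opE (S0 (opP f \* opP g)).

Definition prodB (f g : unit_itv -> R) : unit_itv -> R :=
  opE (opP f \* opP g).

Lemma CI_prodA f g : CI f -> CI g -> CI (prodA f g).
Proof. by move=> cf cg; apply/CI_opE/CI_S0; apply: CI_M; apply: CI_opP. Qed.

Lemma CI_prodB f g : CI f -> CI g -> CI (prodB f g).
Proof. by move=> cf cg; apply: CI_opE; apply: CI_M; apply: CI_opP. Qed.

(* A multiplication on the vector lattice [V] of functions is represented by a
   map on all functions, constrained only on [V]. *)
Definition bilinear_mul (T : Type) (V : set (T -> R))
    (star : (T -> R) -> (T -> R) -> (T -> R)) : Prop :=
  [/\ forall z w, V z -> V w -> V (star z w),
      forall (c : R) z z' w, V z -> V z' -> V w ->
        star ((c \*o z) \+ z') w = (c \*o star z w) \+ star z' w &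
      forall (c : R) z w w', V z -> V w -> V w' ->
        star z ((c \*o w) \+ w') = (c \*o star z w) \+ star z w'].

Definition positive_mul (T : Type) (V : set (T -> R))
    (star : (T -> R) -> (T -> R) -> (T -> R)) : Prop :=
  forall z w, V z -> V w -> (forall p, 0 <= z p) -> (forall p, 0 <= w p) ->
    forall p, 0 <= star z w p.

End UnitInterval.

(* Main.v *)
Require Import Defs.
From mathcomp Require Import all_boot all_order all_algebra.
From mathcomp Require Import all_classical all_reals all_analysis.
From mathcomp Require Import ring lra.

(** Evaluating a positive multiplication at a point turns it into an integral
    operator whose kernel is not of finite rank, while elements of [H] have
    finite rank somewhere.

    Take z(x,y) = (3x - 3y)^+, which lies in [H], and let e = 1 (x) 1.  Fix a
    point p = (p1,p2) and put s = sigma(p1), t = sigma(p2).  The factor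
    [prodB] only sees its arguments at y = t/3, so a tensor 1 (x) k with k
    vanishing at t/3 has product 0 with e at p.  Since
    |z - (3x - t)^+ (x) 1| <= 1 (x) |3y - t|, positivity forces the product
    of z with e to agree at p with that of the elementary tensor
    (3x - t)^+ (x) 1 ([positive_mul_congr]); there the prescribed formula gives
      eta(p1) eta(p2) S_0((x - t)^+)(s)
        = eta(p1) eta(p2) (1 - t - t e^s + e^(st)) / 2,
    by an explicit integration ([S0_ramp]).  All terms except the last are
    tensors, so eta(p1) eta(p2) e^(st) would belong to [H]
    ([fremlin_exp_sigma]).

    On the other hand, the functions that agree with an algebraic tensor on
    some nonempty open part of every nonempty open set form a Riesz subspace
    ([riesz_generically]): where two continuous functions compete in a maximum,
    one of them wins on an open subset.  Hence every element of [H] has this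
    property, and e^(st) would be a sum of n products f_k(s) g_k(t) on some
    open rectangle.  That is absurd, because the (n+1) x (n+1) matrix of e^(st)
    on a grid is a Vandermonde matrix times an invertible diagonal one
    ([expR_grid_rank]). *)

Set Implicit Arguments.
Unset Strict Implicit.
Unset Printing Implicit Defensive.
Import Order.TTheory GRing.Theory Num.Theory.
Import numFieldNormedType.Exports.
Local Open Scope classical_set_scope.
Local Open Scope ring_scope.

(** * Functions that generically agree with a given space *)

(** A function built from [V] by lattice operations coincides with members of
    [V] only in pieces.  This condition records the pieces with nonempty
    interior and is stable under the Riesz operations, so that no normal form
    for the elements of the generated Riesz subspace enters the argument. *)
Definition generically (R : realType) (T : topologicalType)
    (V : set (T -> R)) : set (T -> R) :=
  [set h : T -> R | forall U : set T, open U -> U !=set0 -> exists W : set T,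
     [/\ open W, W !=set0, W `<=` U & exists2 u, V u & {in W, h =1 u}]].

Lemma sub_generically (R : realType) (T : topologicalType) (V : set (T -> R)) :
  V `<=` generically V.
Proof. by move=> h Vh U oU U0; exists U; split=> //; exists h. Qed.

(** Shrinking the open set twice handles two functions at once. *)
Lemma generically2 (R : realType) (T : topologicalType) (V : set (T -> R))
    z w U : generically V z -> generically V w -> open U -> U !=set0 ->
  exists W u v, [/\ open W, W !=set0 & W `<=` U] /\
    [/\ V u, V v, {in W, z =1 u} & {in W, w =1 v}].
Proof.
move=> gz gw oU U0; have [W [oW W0 WU [u Vu zu]]] := gz U oU U0.
have [W' [oW' W'0 W'W [v Vv wv]]] := gw W oW W0.
exists W', u, v; split; split=> //; first exact: subset_trans WU.
by move=> p /set_mem /W'W /mem_set; exact: zu.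
Qed.

Lemma open_gt_continuous (R : realType) (T : topologicalType) (u v : T -> R) :
  continuous u -> continuous v -> open [set p | u p < v p].
Proof.
move=> cu cv.
have -> : [set p | u p < v p] = (fun p => v p - u p) @^-1` [set x | 0 < x].
  by apply/seteqP; split=> p /=; rewrite subr_gt0.
apply: open_comp; last exact: open_gt.
by move=> p _; exact: (@continuousB _ R^o _ v u p (cv p) (cu p)).
Qed.

(** The maximum is the only interesting case: if [z = u] and [w = v] on [W],
    then either [v < u] somewhere, hence by continuity on a nonempty open
    subset, or [u <= v] on all of [W]. *)
Lemma riesz_generically (R : realType) (T : topologicalType)
    (V : set (T -> R)) :
  V `<=` @Cspace R T -> V (cst 0) ->
  (forall u v, V u -> V v -> V (u \+ v)) ->
  (forall (c : R) u, V u -> V (c \*o u)) ->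
  riesz_subspace (generically V).
Proof.
move=> cV V0 VD VZ; split.
- exact: sub_generically.
- move=> z w gz gw U oU U0.
  have [W [u [v [[oW W0 WU] [Vu Vv zu wv]]]]] := generically2 gz gw oU U0.
  exists W; split=> //; exists (u \+ v); first exact: VD.
  by move=> p Wp /=; rewrite zu// wv.
- move=> c z gz U oU U0; have [W [oW W0 WU [u Vu zu]]] := gz U oU U0.
  exists W; split=> //; exists (c \*o u); first exact: VZ.
  by move=> p Wp /=; rewrite zu.
move=> z w gz gw U oU U0.
have [W [u [v [[oW W0 WU] [Vu Vv zu wv]]]]] := generically2 gz gw oU U0.
have [[p Wp vup]|nvu] := pselect (exists2 p, W p & v p < u p).
  exists (W `&` [set q | v q < u q]); split.
  + apply: openI => //; exact: open_gt_continuous (cV _ Vv) (cV _ Vu).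
  + by exists p.
  + by move=> q [/WU].
  + exists u => // q /set_mem[/mem_set Wq vuq] /=.
    by rewrite zu// wv// max_l// ltW.
exists W; split=> //; exists v => // p Wp /=.
rewrite zu// wv// max_r// leNgt; apply/negP => vup.
by apply: nvu; exists p => //; exact: set_mem.
Qed.

(** * Algebraic and Fremlin tensors *)

Section Tensors.
Variable R : realType.
Local Notation I := (unit_itv R).

Lemma alg_tensorD (u v : I * I -> R) :
  alg_tensor u -> alg_tensor v -> alg_tensor (u \+ v).
Proof.
move=> [m [f [g [cf cg ->]]]] [n [h [k [ch ck ->]]]].
pose F (a : 'I_m -> I -> R) (b : 'I_n -> I -> R) (i : 'I_(m + n)) :=
  match fintype.split i with inl j => a j | inr j => b j end.
exists (m + n)%N, (F f h), (F g k); split.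
- by move=> i; rewrite /F; case: fintype.split.
- by move=> i; rewrite /F; case: fintype.split.
apply/funext => p /=; rewrite big_split_ord/=; congr (_ + _).
  by apply: eq_bigr => i _; rewrite /F (unsplitK (inl i)).
by apply: eq_bigr => i _; rewrite /F (unsplitK (inr i)).
Qed.

Lemma alg_tensorZ (c : R) (u : I * I -> R) :
  alg_tensor u -> alg_tensor (c \*o u).
Proof.
move=> [n [f [g [cf cg ->]]]]; exists n, (fun i => c \*o f i), g; split=> //.
  move=> i; have [_ _ VZ _] := @riesz_Cspace R I; exact: VZ (cf i).
apply/funext => p /=; rewrite mulr_sumr.
by apply: eq_bigr => i _; rewrite /elem_tensor /= mulrA.
Qed.

Lemma alg_tensor0 : @alg_tensor R (cst 0).
Proof.
exists 0%N, (fun=> cst 0), (fun=> cst 0); split.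
- by case.
- by case.
- by apply/funext => p; rewrite big_ord0.
Qed.

Lemma riesz_fremlin_tensor : riesz_subspace (@fremlin_tensor R).
Proof.
split.
- by apply: sub_gen_smallest; exact: alg_tensor0.
- move=> z w Hz Hw V [rV sV]; have [_ VD _ _] := rV.
  by apply: VD; [exact: Hz|exact: Hw].
- move=> c z Hz V [rV sV]; have [_ _ VZ _] := rV.
  by apply: VZ; exact: Hz.
- move=> z w Hz Hw V [rV sV]; have [_ _ _ VM] := rV.
  by apply: VM; [exact: Hz|exact: Hw].
Qed.

Lemma fremlin_tensor_generically :
  @fremlin_tensor R `<=` generically (@alg_tensor R).
Proof.
apply: smallest_sub; last exact: sub_generically.
apply: riesz_generically.
- by move=> u au; apply: fremlin_tensor_continuous; exact: sub_gen_smallest.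
- exact: alg_tensor0.
- exact: alg_tensorD.
- exact: alg_tensorZ.
Qed.

End Tensors.

(** * Positivity and pointwise determination *)

(** The map [x |-> star x w p] is a positive linear functional that kills [d],
    hence it kills everything dominated by [d].  This lets a function be
    replaced, point by point, by an elementary tensor. *)
Lemma positive_mul_congr (R : realType) (T : Type) (V : set (T -> R)) star
    (z z' d w : T -> R) (p : T) :
  riesz_subspace V -> bilinear_mul V star -> positive_mul V star ->
  V z -> V z' -> V d -> V w ->
  (forall q, `|z q - z' q| <= d q) -> (forall q, 0 <= w q) ->
  star d w p = 0 -> star z w p = star z' w p.
Proof.
move=> [_ VD VZ _] [_ starDl _] star_ge0 Vz Vz' Vd Vw zz'd w0 dwp.
have le x y : V x -> V y -> (forall q, `|x q - y q| <= d q) ->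
    star x w p <= star y w p.
  move=> Vx Vy xyd; pose s := (1 \*o y) \+ d.
  have Vs : V s by apply: VD => //; exact: VZ.
  have := star_ge0 ((-1 \*o x) \+ s) w _ Vw _ w0 p; rewrite starDl// starDl//=.
  rewrite dwp addr0 mul1r mulN1r addrC subr_ge0; apply.
    by apply: VD => //; exact: VZ.
  move=> q; rewrite /s /= mul1r mulN1r.
  by have := le_trans (ler_norm _) (xyd q); lra.
apply/le_anti/andP; split; apply: le => // q.
by rewrite distrC.
Qed.

(** * The exponential kernel has infinite rank *)

(** With [a_j = expR (c * t_j)] and [s_i = s + i c], the matrix of
    [expR (s_i * t_j) = expR (s * t_j) * a_j ^+ i] is the Vandermonde matrix of
    the distinct [a_j] times an invertible diagonal one, so its rank is [n + 1],
    whereas a sum of [n] products has rank at most [n]. *)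
Lemma expR_grid_rank (R : realType) (s t c d : R) n
    (f g : 'I_n -> nat -> R) : 0 < c -> 0 < d ->
  ~ forall i j, (i <= n)%N -> (j <= n)%N ->
      expR ((s + i%:R * c) * (t + j%:R * d)) = \sum_(k < n) f k i * g k j.
Proof.
move=> c0 d0 fg.
pose a : 'rV[R]_n.+1 := \row_j expR (c * (t + j%:R * d)).
pose b : 'rV[R]_n.+1 := \row_j expR (s * (t + j%:R * d)).
pose F : 'M[R]_(n.+1, n) := \matrix_(i, k) f k i.
pose G : 'M[R]_(n, n.+1) := \matrix_(k, j) g k j.
have VFG : Vandermonde n.+1 a *m diag_mx b = F *m G.
  apply/matrixP => i j; rewrite mul_mx_diag !mxE.
  rewrite -expRM_natl -expRD.
  under eq_bigr do rewrite !mxE.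
  rewrite -fg; [congr expR; ring|exact: (ltn_ord i)|exact: (ltn_ord j)].
have : (F *m G) \in unitmx.
  rewrite -VFG unitmxE unitfE det_mulmx mulf_neq0//.
    rewrite det_Vandermonde; apply/prodf_neq0 => i _.
    apply/prodf_neq0 => j ij; rewrite !mxE subr_eq0.
    rewrite (inj_eq (@expR_inj R)).
    rewrite (inj_eq (mulfI (lt0r_neq0 c0))) (inj_eq (addrI t)).
    rewrite (inj_eq (mulIf (lt0r_neq0 d0))) eqr_nat.
    by rewrite gtn_eqF.
  rewrite det_diag; apply/prodf_neq0 => i _.
  by rewrite !mxE lt0r_neq0// expR_gt0.
rewrite -row_full_unit => /eqnP rFG.
by have := leq_trans (mxrankM_maxl F G) (rank_leq_col F); rewrite rFG ltnn.
Qed.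

(** * The operator [S0] on a ramp *)

(** An antiderivative of [s ^+ 2 * expR (s x) * (x - t)] is
    [expR (s x) * (s (x - t) - 1)]; keeping the factor [s ^+ 2] avoids a
    division by [s], so that [s = 0] is no exception. *)
Lemma Rintegral_expR_ramp (R : realType) (s t : R) : 0 <= t <= 1 ->
  s ^+ 2 * \int[lebesgue_measure]_(x in `[0, 1])
    (expR (s * x) * Num.max (x - t) 0) =
  expR s * (s * (1 - t) - 1) + expR (s * t).
Proof.
move=> /andP[t0 t1].
have cexp : continuous (fun x : R => expR (s * x)).
  move=> x; apply: continuous_comp; last exact: continuous_expR.
  exact: mulrl_continuous.
have ctr : continuous (fun x : R => x - t).
  move=> x; apply: (@continuousB _ R^o _ id (cst t) x); first by move=> ?.
  exact: cst_continuous.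
have cg : continuous (fun x : R => s ^+ 2 * (expR (s * x) * (x - t))).
  move=> x; apply: (@continuousM _ _ (cst (s ^+ 2)) _ x).
    exact: cst_continuous.
  by apply: (@continuousM _ _ _ _ x); [exact: cexp|exact: ctr].
have ch : continuous (fun x : R => expR (s * x) * Num.max (x - t) 0).
  move=> x; apply: (@continuousM _ _ _ _ x); first exact: cexp.
  apply: (@continuous_max R _ (fun x => x - t) (cst 0)); first exact: ctr.
  exact: cst_continuous.
have ih : lebesgue_measure.-integrable `[0, 1]
    (EFin \o (fun x : R => expR (s * x) * Num.max (x - t) 0)).
  apply: continuous_compact_integrable; first exact: segment_compact.
  exact: continuous_subspaceT.
pose F (x : R) := expR (s * x) * (s * (x - t) - 1).
have dF (x : R) : is_derive x 1 F (s ^+ 2 * (expR (s * x) * (x - t))).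
  rewrite /F; apply: is_derive_eq.
  by rewrite /GRing.scale/=; ring.
have cF : continuous F.
  by move=> x; apply/differentiable_continuous/derivable1_diffP; case: (dF x).
rewrite -RintegralZl//; set h := fun x : R => _ * (_ * _).
have ih' : lebesgue_measure.-integrable `[0, 1] (EFin \o h).
  apply: continuous_compact_integrable; first exact: segment_compact.
  apply: continuous_subspaceT => x.
  apply: (@continuousM _ _ (cst (s ^+ 2)) _ x); last exact: ch.
  exact: cst_continuous.
have := @Rintegral_itvB R h (BLeft 0) (BRight 1) t ih'.
rewrite !bnd_simp => /(_ t0 t1).
have -> : \int[lebesgue_measure]_(x in `[0, t]) h x = 0.
  rewrite (@eq_Rintegral _ _ _ _ _ (cst 0)) ?Rintegral_cst ?mul0r//.
  move=> x; rewrite inE/= in_itv/= => /andP[_ xt].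
  by rewrite /h max_r ?mulr0// subr_le0.
rewrite subr0 => ->.
rewrite Rintegral_itv_obnd_cbnd; last first.
  apply: integrableS ih' => //; apply: subset_itvr.
  by rewrite bnd_simp.
transitivity (\int[lebesgue_measure]_(x in `[t, 1])
    (s ^+ 2 * (expR (s * x) * (x - t)))).
  apply: eq_Rintegral.
  move=> x; rewrite inE/= in_itv/= => /andP[tx _].
  by rewrite /h max_l// subr_ge0.
(* The fundamental theorem of calculus asks for a nondegenerate interval. *)
move: t1; rewrite le_eqVlt => /predU1P[->|t1].
  by rewrite set_itv1 Rintegral_set1 mulr1; ring.
rewrite /Rintegral (@continuous_FTC2 _ _ F)//=.
- by rewrite /F mulr1; ring.
- exact: continuous_subspaceT.
- split.
  + by move=> x _; case: (dF x).
  + exact: cvg_at_right_filter (cF t).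
  + exact: cvg_at_left_filter (cF 1).
- by move=> x _; rewrite derive1E; case: (dF x).
Qed.

Section UnitSquare.
Variable R : realType.
Local Notation I := (unit_itv R).

(** The slope [3] compensates the contraction [x |-> x / 3] in [opP]. *)
Definition ramp (t : R) : I -> R := fun x => Num.max (3 * ival x - t) 0.

(** The terms in [ival s * expR (ival s)] of [coef_b] and of the integral
    cancel; only [expR (ival s * t)] does not split into one-variable
    factors. *)
Lemma S0_ramp (t : R) (s : I) : 0 <= t <= 1 ->
  S0 (opP (ramp t) \* opP (cst 1)) s =
  (1 - t - t * expR (ival s) + expR (ival s * t)) / 2.
Proof.
move=> t01; have /andP[t0 t1] := t01; rewrite /S0.
have Pf (x : I) : (opP (ramp t) \* opP (cst 1)) x = Num.max (ival x - t) 0.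
  rewrite /opP /ramp /= mulr1 /mk_itv /ival /=.
  by congr (Num.max (_ - _) _); rewrite mulrC divfK.
have -> : \int[lebesgue_measure]_(x in `[0, 1])
      (expR (ival s * x) * 'valL_0 (opP (ramp t) \* opP (cst 1)) x) =
    \int[lebesgue_measure]_(x in `[0, 1])
      (expR (ival s * x) * Num.max (x - t) 0).
  apply: eq_Rintegral.
  move=> x; rewrite inE/= => x01; congr (_ * _).
  have x01' : 0 <= x <= 1 by move: x01; rewrite in_itv.
  exact: etrans (ext_ival _ (mk_itv x01')) (Pf _).
rewrite [_ ^+ 2 / 2 * _]mulrAC Rintegral_expR_ramp// !Pf /coef_a /coef_b.
have -> : ival (itv0 R) = 0 by [].
have -> : ival (itv1 R) = 1 by [].
rewrite [Num.max (0 - t) 0]max_r; last lra.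
rewrite [Num.max (1 - t) 0]max_l; last lra.
by field.
Qed.

(** * The exponential kernel is not locally an algebraic tensor *)

Lemma right_nbhs_ival (p : I) (A : set I) : nbhs p A -> ival p < 1 ->
  exists2 e, 0 < e & forall x, ival p <= x < ival p + e ->
    exists2 q, A q & ival q = x.
Proof.
rewrite nbhsE => -[_ [[B oB <-] pB] BA] p1.
have /nbhs_ballP[e /= e0 eB] : nbhs (ival p) B by exact: open_nbhs_nbhs.
exists (Num.min e (1 - ival p)).
  by rewrite lt_min e0 subr_gt0.
move=> x /andP[px]; rewrite -ltrBlDl lt_min => /andP[xe x1].
have /andP[p0 _] := ivalP p.
have x01 : 0 <= x <= 1 by lra.
exists (mk_itv x01) => //; apply: BA; apply: eB.
by rewrite /ball/= distrC ger0_norm ?subr_ge0.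
Qed.

Lemma right_grid (p : I) (A : set I) n : nbhs p A -> ival p < 1 ->
  exists2 c, 0 < c & exists q : nat -> I,
    forall i, (i <= n)%N -> A (q i) /\ ival (q i) = ival p + i%:R * c.
Proof.
move=> pA p1; have [e e0 eA] := right_nbhs_ival pA p1.
have /choice[q qP] : forall i, exists q : I, (i <= n)%N ->
    A q /\ ival q = ival p + i%:R * (e / n.+1%:R).
  move=> i; have [ni|ni] := leqP i n; last by exists p.
  have [|q Aq qE] := eA (ival p + i%:R * (e / n.+1%:R)); last by exists q.
  rewrite lerDl mulr_ge0 ?divr_ge0 ?ler0n ?ltW//= ltrD2l mulrCA.
  by rewrite gtr_pMr// ltr_pdivrMr// mul1r ltr_nat ltnS.
by exists (e / n.+1%:R); [rewrite divr_gt0|exists q].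
Qed.

(** The arguments [3 r - 2] are the values of [sigma] for [r >= 2 / 3].
    Staying below [1] leaves room for an arithmetic progression to the right of
    a point of [W]. *)
Lemma expR_not_alg_tensor (W : set (I * I)) (u : I * I -> R) :
  open W -> W !=set0 -> W `<=` [set p | ival p.1 < 1 /\ ival p.2 < 1] ->
  alg_tensor u ->
  ~ {in W, forall p, expR ((3 * ival p.1 - 2) * (3 * ival p.2 - 2)) = u p}.
Proof.
move=> oW [p Wp] W1 [n [f [g [_ _ ->]]]] Wu.
have [p1 p2] := W1 p Wp.
have [[A B] /= [pA pB] ABW] : nbhs p W by exact: open_nbhs_nbhs.
have [c c0 [q qE]] := @right_grid p.1 A n pA p1.
have [d d0 [r rE]] := @right_grid p.2 B n pB p2.
apply: (@expR_grid_rank R (3 * ival p.1 - 2) (3 * ival p.2 - 2) (3 * c) (3 * d)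
  n (fun k i => f k (q i)) (fun k j => g k (r j))); [by rewrite mulr_gt0..|].
move=> i j ni nj; have [Aq qi] := qE i ni; have [Br rj] := rE j nj.
have /mem_set/Wu/= : W (q i, r j) by exact: ABW.
by rewrite qi rj => <-; congr expR; ring.
Qed.

(** * Membership in the function spaces *)

Lemma CI_cst (c : R) : CI (cst c : I -> R).
Proof. by move=> x; exact: cst_continuous. Qed.

Lemma CI_max0 (f : I -> R) : CI f -> CI (fun x => Num.max (f x) 0).
Proof.
by move=> cf; have [_ _ _] := @riesz_Cspace R I; apply; last exact: CI_cst.
Qed.

Lemma CI_ramp (t : R) : CI (ramp t : I -> R).
Proof. by apply: CI_max0; exact: continuous_affine. Qed.

Lemma CI_ival_sigma : CI (fun r : I => ival (sigma r)).
Proof. by apply: CI_max0; exact: continuous_affine. Qed.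

Lemma CI_normB (t : R) : CI (fun y : I => `|3 * ival y - t|).
Proof.
move=> y; apply: (@continuous_comp I R R (fun y => 3 * ival y - t) Num.norm).
  exact: continuous_affine.
exact: norm_continuous.
Qed.

Lemma CI_expR_sigma : CI (fun r : I => expR (ival (sigma r))).
Proof.
move=> r; apply: (@continuous_comp I R R (fun r => ival (sigma r)) (@expR R)).
  exact: CI_ival_sigma.
exact: continuous_expR.
Qed.

Definition diag_ramp : I * I -> R :=
  fun p => Num.max (3 * ival p.1 - 3 * ival p.2) 0.

Lemma fremlin_diag_ramp : fremlin_tensor diag_ramp.
Proof.
have [H0 HD HZ HM] := riesz_fremlin_tensor R.
have C3 : CI (fun x : I => 3 * ival x).
  have -> : (fun x : I => 3 * ival x) = (fun x => 3 * ival x - 0).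
    by apply/funext => x; rewrite subr0.
  exact: continuous_affine.
have -> : diag_ramp =
    (elem_tensor (fun x => 3 * ival x) (cst 1) \+
     (-1 \*o elem_tensor (cst 1) (fun x => 3 * ival x))) \max cst 0.
  by apply/funext => p; rewrite /diag_ramp /elem_tensor /= mulr1 mul1r mulN1r.
apply: HM H0; apply: HD; last apply: HZ;
  by apply: fremlin_tensor_elem => //; exact: CI_cst.
Qed.

Lemma diag_ramp_approx (t : R) (p : I * I) :
  `|diag_ramp p - elem_tensor (ramp t) (cst 1) p| <=
  elem_tensor (cst 1) (fun y => `|3 * ival y - t|) p.
Proof.
rewrite /diag_ramp /elem_tensor /ramp /= mulr1 mul1r.
set a := 3 * ival p.1; set b := 3 * ival p.2.
case: (leP 0 (b - t)) => h; [rewrite (ger0_norm h)|rewrite (ltr0_norm h)];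
rewrite ler_norml; case: (leP (a - b) 0); case: (leP (a - t) 0); lra.
Qed.

(** * The product of the diagonal ramp with the unit *)

(** [diag_ramp] is compared with the tensor [ramp t (x) 1], where [t] is frozen
    at the second coordinate of the point of evaluation. *)
Lemma star_diag_ramp
    (star : (I * I -> R) -> (I * I -> R) -> I * I -> R)
    p (s := ival (sigma p.1)) (t := ival (sigma p.2))
    (one := elem_tensor (cst 1) (cst 1)) :
  bilinear_mul (@fremlin_tensor R) star ->
  positive_mul (@fremlin_tensor R) star ->
  (forall f h g k : I -> R, CI f -> CI h -> CI g -> CI k ->
    star (elem_tensor f g) (elem_tensor h k) =
    elem_tensor (prodA f h) (prodB g k)) ->
  star diag_ramp one p =
  eta p.1 * eta p.2 * ((1 - t - t * expR s + expR (s * t)) / 2).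
Proof.
move=> starL star_ge0 starE; have C1 := @CI_cst 1.
have -> : star diag_ramp one p = star (elem_tensor (ramp t) (cst 1)) one p.
  apply: (positive_mul_congr (riesz_fremlin_tensor R) starL star_ge0
    (d := elem_tensor (cst 1) (fun y => `|3 * ival y - t|))).
  - exact: fremlin_diag_ramp.
  - by apply: fremlin_tensor_elem => //; exact: CI_ramp.
  - by apply: fremlin_tensor_elem => //; exact: CI_normB.
  - exact: fremlin_tensor_elem.
  - exact: diag_ramp_approx.
  - by move=> q; rewrite /one /elem_tensor /= mulr1.
  (* At this point [opP] evaluates [|3 y - t|] at [y = t / 3], its zero. *)
  rewrite starE//; last exact: CI_normB.
  rewrite /elem_tensor /prodB /opE /opP /= [ival (mk_itv _)]/(t / 3).
  by rewrite [3 * _]mulrC divfK// subrr normr0 !(mul0r, mulr0).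
rewrite starE//; last exact: CI_ramp.
rewrite /elem_tensor /prodA /prodB /opE S0_ramp; last exact: ivalP.
by rewrite -/s -/t /opP /= !mulr1 mulrAC.
Qed.

Lemma fremlin_exp_sigma
    (star : (I * I -> R) -> (I * I -> R) -> I * I -> R) :
  bilinear_mul (@fremlin_tensor R) star ->
  positive_mul (@fremlin_tensor R) star ->
  (forall f h g k : I -> R, CI f -> CI h -> CI g -> CI k ->
    star (elem_tensor f g) (elem_tensor h k) =
    elem_tensor (prodA f h) (prodB g k)) ->
  fremlin_tensor (fun p : I * I =>
    eta p.1 * eta p.2 * expR (ival (sigma p.1) * ival (sigma p.2))).
Proof.
move=> starL star_ge0 starE.
have [_ HD HZ _] := riesz_fremlin_tensor R.
have [starH _ _] := starL.
have C1 := @CI_cst 1.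
pose one : I * I -> R := elem_tensor (cst 1) (cst 1).
pose es := elem_tensor (@eta R) (@eta R).
pose e1 := elem_tensor (@eta R) (@eta R \* (fun y => ival (sigma y))).
pose e2 := elem_tensor (@eta R \* (fun x => expR (ival (sigma x))))
  (@eta R \* (fun y => ival (sigma y))).
have -> : (fun p : I * I =>
    eta p.1 * eta p.2 * expR (ival (sigma p.1) * ival (sigma p.2))) =
  (2 \*o star diag_ramp one) \+ ((-1 \*o es) \+ (e1 \+ e2)).
  apply/funext => p /=; rewrite star_diag_ramp// /es /e1 /e2 /elem_tensor /=.
  by field.
have C2 : CI (@eta R \* (fun y => ival (sigma y))).
  by apply: CI_M; [exact: CI_eta|exact: CI_ival_sigma].
have C3 : CI (@eta R \* (fun y => expR (ival (sigma y)))).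
  by apply: CI_M; [exact: CI_eta|exact: CI_expR_sigma].
have Hz : fremlin_tensor (star diag_ramp one).
  by apply: starH; [exact: fremlin_diag_ramp|exact: fremlin_tensor_elem].
have Hes : fremlin_tensor es by apply: fremlin_tensor_elem; exact: CI_eta.
have He1 : fremlin_tensor e1.
  by apply: fremlin_tensor_elem => //; exact: CI_eta.
have He2 : fremlin_tensor e2 by exact: fremlin_tensor_elem.
by apply: (HD); [exact: HZ|apply: (HD); [exact: HZ|exact: HD]].
Qed.

End UnitSquare.

(** * Nonexistence of the positive multiplication *)

Theorem theorem4p1 (R : realType) :
  ~ exists star : (unit_itv R * unit_itv R -> R) ->
                  (unit_itv R * unit_itv R -> R) ->
                  (unit_itv R * unit_itv R -> R),
      [/\ bilinear_mul (@fremlin_tensor R) star,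
          positive_mul (@fremlin_tensor R) star &
          forall f h g k : unit_itv R -> R, CI f -> CI h -> CI g -> CI k ->
            star (elem_tensor f g) (elem_tensor h k) = elem_tensor (prodA f h) (prodB g k)].
Proof.
move=> [star [starL star_ge0 starE]].
have /fremlin_tensor_generically gexp := fremlin_exp_sigma starL star_ge0 starE.
(* On this range [eta] is [1] and [sigma] is affine. *)
pose J : set R := [set x | 2 / 3 < x < 1].
pose U : set (unit_itv R * unit_itv R) :=
  [set p | J (ival p.1) /\ J (ival p.2)].
have oJ : open [set r : unit_itv R | J (ival r)].
  have -> : [set r : unit_itv R | J (ival r)] =
      [set r | cst (2 / 3) r < ival r] `&` [set r | ival r < cst 1 r].
    by apply/seteqP; split=> r; [move/andP|move=> ?; apply/andP].
  by apply: openI; apply: open_gt_continuous;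
    first [exact: continuous_ival|exact: CI_cst].
have oU : open U.
  apply: openI; [apply: (open_comp (f := fst) _ oJ)|
    apply: (open_comp (f := snd) _ oJ)] => p _; [exact: cvg_fst|exact: cvg_snd].
have U0 : U !=set0.
  have x01 : 0 <= (5 / 6 : R) <= 1 by lra.
  have Jx : J (5 / 6) by rewrite /J/=; lra.
  by exists (mk_itv x01, mk_itv x01); split; exact: Jx.
have [W [oW W0 WU [u au uE]]] := gexp U oU U0.
apply: (expR_not_alg_tensor oW W0 _ au).
  by move=> p /WU[/andP[_ p1] /andP[_ p2]].
move=> p Wp; rewrite -uE//.
have eta1 (r : unit_itv R) : J (ival r) ->
    eta r = 1 /\ ival (sigma r) = 3 * ival r - 2.
  move=> /andP[r1 r2]; split.
    by rewrite /eta !ifF//; apply/negbTE; lra.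
  have -> : ival (sigma r) = Num.max (3 * ival r - 2) 0 by [].
  by rewrite max_l//; lra.
have /set_mem/WU[/eta1[-> ->] /eta1[-> ->]] := Wp.
by rewrite !mul1r.
Qed.
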